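(* Let $>$ be a reduction order and let $\Gamma\colon(\mathcal{E}_0,\mathcal{R}_0)\vdash_{\mathsf i}(\mathcal{E}_1,\mathcal{R}_1)\vdash_{\mathsf i}(\mathcal{E}_2,\mathcal{R}_2)\vdash_{\mathsf i}\cdots$ be an infinite run (with $\mathcal{R}_0=\varnothing$) of $\mathsf{KB_i}$ with respect to $>$. If $\Gamma$ is fair then $\mathcal{R}_\omega$ is a complete presentation of $\mathcal{E}_0$.
   Context: Terms are built from a signature $\mathcal{F}$ and an infinite set of variables $\mathcal{V}$. An equational system (ES) is a set of pairs of terms $s\approx t$; a TRS is a set of pairs $\ell\to r$ with $\ell$ not a variable and every variable of $r$ occurring in $\ell$. For a set $X$ of pairs of terms, $\to_X$ is its closure under contexts and substitutions, $\leftrightarrow_X$ the symmetric closure of $\to_X$, $\leftrightarrow_X^*$ the conversion relation, and $\downarrow_X\,=\,\to_X^*\cdot{}_X^*{\leftarrow}$ joinability. A TRS is complete if it is terminating and confluent; $\mathcal{R}$ is a complete presentation of $\mathcal{E}$ if $\mathcal{R}$ is complete and $\leftrightarrow_{\mathcal{R}}^*\,=\,\leftrightarrow_{\mathcal{E}}^*$. A reduction order is a well-founded strict order on terms closed under contexts and substitutions. A term $s$ encompasses $t$ if $s=C[t\sigma]$ for some context $C$ and substitution $\sigma$; $s$ properly encompasses $t$ if $s$ encompasses $t$ but $t$ does not encompass $s$. Prime critical pairs: an overlap of $\mathcal{R}$ is a triple $\langle \ell_1\to r_1,p,\ell_2\to r_2\rangle$ where the two rules are variants (up to bijective variable renaming)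 of rules of $\mathcal{R}$ without common variables, $p$ is a non-variable position of $\ell_2$, $\ell_1$ and $\ell_2|_p$ are unifiable, and if $p=\epsilon$ the two rules are not variants of each other. With $\sigma$ a most general unifier of $\ell_1$ and $\ell_2|_p$, the critical pair is $\ell_2\sigma[r_1\sigma]_p\approx r_2\sigma$. It is prime if all proper subterms of $\ell_2\sigma|_p$ are normal forms with respect to $\mathcal{R}$. $\mathrm{PCP}(\mathcal{R})$ is the set of prime critical pairs of $\mathcal{R}$. Inference system $\mathsf{KB_i}$ ($\uplus$ is disjoint union): $(\mathcal{E},\mathcal{R})\vdash_{\mathsf i}(\mathcal{E}',\mathcal{R}')$ if it is an instance of one of - deduce: $(\mathcal{E},\mathcal{R})\vdash(\mathcal{E}\cup\{s\approx t\},\mathcal{R})$ if $s\,{}_{\mathcal{R}}{\leftarrow}\cdot\to_{\mathcal{R}}t$; - orient: $(\mathcal{E}\uplus\{s\approx t\},\mathcal{R})\vdash(\mathcal{E},\mathcal{R}\cup\{s\to t\})$ if $s>t$, and $(\mathcal{E}\uplus\{s\approx t\},\mathcal{R})\vdash(\mathcal{E},\mathcal{R}\cup\{t\to s\})$ if $t>s$; - delete: $(\mathcal{E}\uplus\{s\approx s\},\mathcal{R})\vdash(\mathcal{E},\mathcal{R})$; - compose: $(\mathcal{E},\mathcal{R}\uplus\{s\to t\})\vdash(\mathcal{E},\mathcal{R}\cup\{s\to u\})$ if $t\to_{\mathcal{R}}u$; - simplify: $(\mathcal{E}\uplus\{s\approx t\},\mathcal{R})\vdash(\mathcal{E}\cup\{u\approx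 t\},\mathcal{R})$ if $s\to_{\mathcal{R}}u$, and $(\mathcal{E}\uplus\{s\approx t\},\mathcal{R})\vdash(\mathcal{E}\cup\{s\approx u\},\mathcal{R})$ if $t\to_{\mathcal{R}}u$; - collapse: $(\mathcal{E},\mathcal{R}\uplus\{t\to s\})\vdash(\mathcal{E}\cup\{u\approx s\},\mathcal{R})$ if $t\to u$ by a rewrite step using some rule $\ell\to r\in\mathcal{R}$ such that $t$ properly encompasses $\ell$. For an infinite run put $\mathcal{E}_\infty=\bigcup_{i\ge0}\mathcal{E}_i$, $\mathcal{R}_\infty=\bigcup_{i\ge0}\mathcal{R}_i$, $\mathcal{E}_\omega=\bigcup_{i\ge0}\bigcap_{j\ge i}\mathcal{E}_j$, $\mathcal{R}_\omega=\bigcup_{i\ge0}\bigcap_{j\ge i}\mathcal{R}_j$. The run is fair if $\mathcal{E}_\omega=\varnothing$ and $\mathrm{PCP}(\mathcal{R}_\omega)\subseteq{\downarrow_{\mathcal{R}_\omega}}\cup{\leftrightarrow_{\mathcal{E}_\infty}}$. *)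

(* Defs.v *)
From mathcomp Require Import all_boot.
From mathcomp Require Import boolp classical_sets functions cardinality.
From Stdlib Require Import Relation_Operators.

Set Implicit Arguments.
Unset Strict Implicit.
Unset Printing Implicit Defensive.

Local Open Scope classical_set_scope.

Inductive term (F : Type) (ar : F -> nat) (V : Type) : Type :=
| Var of V
| App (f : F) of ('I_(ar f) -> term ar V).

Arguments Var {F ar V} _.
Arguments App {F ar V} _ _.

(* The component [ts i] of [CApp f i ts C] is irrelevant: that argument is [C]. *)
Inductive context (F : Type) (ar : F -> nat) (V : Type) : Type :=
| Hole
| CApp (f : F) (i : 'I_(ar f)) of ('I_(ar f) -> term ar V) & context ar V.

Arguments Hole {F ar V}.
Arguments CApp {F ar V} _ _ _ _.

Section Rewriting.
Context {F : Type} {ar : F -> nat} {V : Type}.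
Local Notation T := (term ar V).

Implicit Types (s t u l r : T) (p q : seq nat) (sigma tau : V -> T).

Fixpoint fill (C : context ar V) t : T :=
  match C with
  | Hole => t
  | CApp f i ts D => App f (fun j => if j == i then fill D t else ts j)
  end.

Fixpoint subst sigma t : T :=
  match t with
  | Var x => sigma x
  | App f ts => App f (fun i => subst sigma (ts i))
  end.

Fixpoint vars t : set V :=
  match t with
  | Var x => [set x]
  | App f ts => \bigcup_i vars (ts i)
  end.

Definition is_var t : Prop := exists x, t = Var x.

(* Argument positions are counted from 0; [None] means that [p] is not a
   position of [t]. *)
Fixpoint subterm_at t p : option T :=
  match p, t with
  | [::], _ => Some t
  | k :: q, App f ts =>
      if insub k is Some i then subterm_at (ts i) q else None
  | _ :: _, Var _ => None
  end.

(* [t] is returned unchanged if [p] is not a position of [t]. *)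
Fixpoint replace_at t p u : T :=
  match p, t with
  | [::], _ => u
  | k :: q, App f ts =>
      App f (fun j => if val j == k then replace_at (ts j) q u else ts j)
  | _ :: _, Var x => Var x
  end.

Definition proper_subterm u t : Prop :=
  exists2 p, p != [::] & subterm_at t p = Some u.

Definition encompasses s t : Prop :=
  exists C sigma, s = fill C (subst sigma t).

Definition properly_encompasses s t : Prop :=
  encompasses s t /\ ~ encompasses t s.

Record reduction_order (gt : T -> T -> Prop) : Prop := {
  gt_irreflexive : forall s, ~ gt s s;
  gt_transitive : forall s t u, gt s t -> gt t u -> gt s u;
  gt_well_founded : well_founded (fun t s => gt s t);
  gt_context : forall C s t, gt s t -> gt (fill C s) (fill C t);
  gt_subst : forall sigma s t, gt s t -> gt (subst sigma s) (subst sigma t)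
}.

(* Equational systems and rewrite systems are both sets of ordered pairs. *)
Implicit Types (X E R : set (T * T)).

Definition is_trs R : Prop :=
  forall l r, R (l, r) -> ~ is_var l /\ vars r `<=` vars l.

Inductive rstep X : T -> T -> Prop :=
| RStep C sigma l r :
    X (l, r) -> rstep X (fill C (subst sigma l)) (fill C (subst sigma r)).

Definition rsteps X : T -> T -> Prop := clos_refl_trans T (rstep X).

Definition symstep X s t : Prop := rstep X s t \/ rstep X t s.

Definition conversion X : T -> T -> Prop := clos_refl_trans T (symstep X).

Definition joinable X s t : Prop := exists2 u, rsteps X s u & rsteps X t u.

Definition normal_form X s : Prop := forall t, ~ rstep X s t.

Definition terminating R : Prop := well_founded (fun t s => rstep R s t).

Definition confluent R : Prop :=
  forall s t u, rsteps R s t -> rsteps R s u -> joinable R t u.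

Definition complete R : Prop := terminating R /\ confluent R.

Definition complete_presentation R E : Prop :=
  [/\ is_trs R, complete R & forall s t, conversion R s t <-> conversion E s t].

Definition variant (rl rl' : T * T) : Prop :=
  exists2 rho : V -> V, bijective rho &
    rl' = (subst (Var \o rho) rl.1, subst (Var \o rho) rl.2).

Definition rule_vars (rl : T * T) : set V := vars rl.1 `|` vars rl.2.

Definition unifier sigma s t : Prop := subst sigma s = subst sigma t.

Definition mgu sigma s t : Prop :=
  unifier sigma s t /\
  forall tau, unifier tau s t ->
    exists delta, forall x, tau x = subst delta (sigma x).

Definition variant_of_rule R (rl : T * T) : Prop :=
  exists2 rl0, R rl0 & variant rl0 rl.

Record overlap R (rl1 : T * T) p (rl2 : T * T) : Prop := {
  overlap_rule1 : variant_of_rule R rl1;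
  overlap_rule2 : variant_of_rule R rl2;
  overlap_disjoint : rule_vars rl1 `&` rule_vars rl2 = set0;
  overlap_unifiable : exists u, [/\ subterm_at rl2.1 p = Some u, ~ is_var u &
    exists tau, unifier tau rl1.1 u];
  overlap_root : p = [::] -> ~ variant rl1 rl2
}.

(* Most general unifiers are unique up to renaming only; every choice
   contributes a pair. *)
Definition PCP R : set (T * T) := [set st | exists l1 r1 p l2 r2 u sigma,
  [/\ overlap R (l1, r1) p (l2, r2),
      subterm_at l2 p = Some u,
      mgu sigma l1 u,
      forall v w, subterm_at (subst sigma l2) p = Some v ->
        proper_subterm w v -> normal_form R w &
      st = (replace_at (subst sigma l2) p (subst sigma r1), subst sigma r2)]].

(* That every [R] reachable from the empty set is a rewrite system in the sense
   of [is_trs] is not required here: it follows from [R] being included in the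
   reduction order. *)
Inductive kb_step (gt : T -> T -> Prop) :
  set (T * T) -> set (T * T) -> set (T * T) -> set (T * T) -> Prop :=
| kb_deduce E R s t u :
    rstep R u s -> rstep R u t ->
    kb_step gt E R (E `|` [set (s, t)]) R
| kb_orient_lr E R s t :
    ~ E (s, t) -> gt s t ->
    kb_step gt (E `|` [set (s, t)]) R E (R `|` [set (s, t)])
| kb_orient_rl E R s t :
    ~ E (s, t) -> gt t s ->
    kb_step gt (E `|` [set (s, t)]) R E (R `|` [set (t, s)])
| kb_delete E R s :
    ~ E (s, s) ->
    kb_step gt (E `|` [set (s, s)]) R E R
| kb_compose E R s t u :
    ~ R (s, t) -> rstep R t u ->
    kb_step gt E (R `|` [set (s, t)]) E (R `|` [set (s, u)])
| kb_simplify_l E R s t u :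
    ~ E (s, t) -> rstep R s u ->
    kb_step gt (E `|` [set (s, t)]) R (E `|` [set (u, t)]) R
| kb_simplify_r E R s t u :
    ~ E (s, t) -> rstep R t u ->
    kb_step gt (E `|` [set (s, t)]) R (E `|` [set (s, u)]) R
| kb_collapse E R t s u l r :
    ~ R (t, s) -> R (l, r) ->
    rstep [set (l, r)] t u -> properly_encompasses t l ->
    kb_step gt E (R `|` [set (t, s)]) (E `|` [set (u, s)]) R.

Definition infinite_run gt (E R : nat -> set (T * T)) : Prop :=
  R 0 = set0 /\ forall i, kb_step gt (E i) (R i) (E i.+1) (R i.+1).

Definition run_union (X : nat -> set (T * T)) : set (T * T) := \bigcup_i X i.

Definition persistent (X : nat -> set (T * T)) : set (T * T) :=
  \bigcup_i \bigcap_(j in [set j | i <= j]) X j.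

Definition fair (E R : nat -> set (T * T)) : Prop :=
  persistent E = set0 /\
  forall s t, PCP (persistent R) (s, t) ->
    joinable (persistent R) s t \/ symstep (run_union E) s t.

End Rewriting.

(* Main.v *)
(* A rule of R_oo that is composed away or collapsed, and an equation of E_oo
   that is oriented, deleted or simplified, is replaced by pieces that are
   smaller for the reduction order combined with proper encompassment.  By
   well-founded induction every rule l -> r of R_oo is therefore an R_w-conversion
   through terms below l, and every equation s = t of E_oo an R_w-conversion
   through terms below s or below t.  In particular prime critical pairs that
   belong to E_oo are connected below their source, and so are the remaining
   peaks: a non-prime peak is split at an innermost redex into two prime ones.
   Connectedness below the source gives confluence of the terminating R_w. *)
Require Import Defs.
From mathcomp Require Import all_boot.
From mathcomp Require Import boolp classical_sets functions cardinality.
From Stdlib Require Import Relation_Operators Operators_Properties.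
From Stdlib Require Import Wellfounded.Inclusion.

Set Implicit Arguments.
Unset Strict Implicit.
Unset Printing Implicit Defensive.

Local Open Scope classical_set_scope.

(** Deleting [y] from the distinct elements loses no value of [h], because [x] remains and has the
    same image. *)
Lemma undup_map_lt (T U : eqType) (h : T -> U) (L : seq T) x y :
  x \in L -> y \in L -> h x = h y -> x <> y ->
  size (undup (map h L)) < size (undup L).
Proof.
move=> xL yL hxy /eqP xy; have yU : y \in undup L by rewrite mem_undup.
have : size (undup (map h L)) <= size (map h (rem y (undup L))).
  apply: uniq_leq_size; first exact: undup_uniq.
  move=> z; rewrite mem_undup => /mapP[w wL ->].
  have [->|wy] := eqVneq w y; rewrite -?hxy map_f // mem_rem_uniq ?undup_uniq //.
    by rewrite inE mem_undup xL xy.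
  by rewrite inE mem_undup wL wy.
by rewrite size_map size_rem //; case: (undup L) yU.
Qed.

(** * Renaming finitely many variables apart *)

Section Renaming.
Context {V : Type}.

(** The type [{classic V}] is [V] with a classically decided equality, which supports lists of
    variables and transpositions. *)
Definition swap (a b : {classic V}) (y : {classic V}) : {classic V} :=
  if y == a then b else if y == b then a else y.

Lemma swapK a b : involutive (swap a b).
Proof.
move=> y; rewrite /swap; have [->|ya] := eqVneq y a.
  by rewrite eqxx; case: eqVneq.
have [->|yb] := eqVneq y b; first by rewrite eqxx.
by rewrite (negbTE ya) (negbTE yb).
Qed.

Lemma exists_fresh : infinite_set [set: V] ->
  forall W : seq {classic V}, exists z, z \notin W.
Proof.
move=> Vinf W; apply: contrapT => /forallNP nz; apply: Vinf.
apply: (@sub_finite_set {classic V} _ [set` W]); last exact: finite_seq.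
by move=> z _ /=; apply/negPn/negP; exact: nz.
Qed.

(** By induction on [A], the renaming is followed by a transposition of the image of the new
    variable with a fresh [z]. As [z] avoids [B] and the images of the earlier variables, those
    images stay outside [B]. *)
Lemma rename_apart (A B : seq {classic V}) : infinite_set [set: V] ->
  exists2 rho : {classic V} -> {classic V},
    bijective rho & forall a, a \in A -> rho a \notin B.
Proof.
move=> Vinf; elim: A => [|a A [rho rho_bij rhoP]].
  by exists id => //; exists id.
have [z] := exists_fresh Vinf (B ++ map rho A).
rewrite mem_cat negb_or => /andP[zB zA].
exists (swap (rho a) z \o rho).
  by apply: bij_comp => //; exists (swap (rho a) z); exact: swapK.
move=> y; rewrite /swap /=; case: eqP => [//|ya].
rewrite inE => /predU1P[ya'|yA]; first by rewrite ya' in ya.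
case: eqP => [yz|_]; last exact: rhoP.
by case/negP: zA; rewrite -yz map_f.
Qed.

End Renaming.

(** * Terms, contexts and substitutions *)

Section Terms.
Context {F : Type} {ar : F -> nat} {V : Type}.
Local Notation T := (term ar V).
Local Notation ctx := (context ar V).
Implicit Types (s t u v w l r : T) (C D : ctx) (sigma tau : V -> T).

Lemma App_head f g (ts : 'I_(ar f) -> T) (us : 'I_(ar g) -> T) :
  App f ts = App g us -> f = g.
Proof. by case. Qed.

(** The arguments have a type depending on [f], so they are extracted by a projection that casts
    along a classically decided equality of symbols; proof irrelevance removes the cast. *)
Lemma App_inj f (ts us : 'I_(ar f) -> T) : App f ts = App f us -> ts = us.
Proof.
pose args t : 'I_(ar f) -> T :=
  if t is App g vs then
    if pselect (g = f) is left e
    then eq_rect g (fun h => 'I_(ar h) -> T) vs f e else ts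
  else ts.
move=> /(congr1 args); rewrite /args; case: pselect => // e.
by rewrite (Prop_irrelevance e erefl).
Qed.

Fixpoint comp_ctx C D : ctx :=
  if C is CApp f i ts C' then CApp f i ts (comp_ctx C' D) else D.

Lemma fill_comp C D t : fill (comp_ctx C D) t = fill C (fill D t).
Proof. by elim: C => //= f i ts C ->. Qed.

Fixpoint subst_ctx sigma C : ctx :=
  if C is CApp f i ts C' then
    CApp f i (fun j => subst sigma (ts j)) (subst_ctx sigma C')
  else Hole.

Lemma subst_fill sigma C t :
  subst sigma (fill C t) = fill (subst_ctx sigma C) (subst sigma t).
Proof.
elim: C => //= f i ts C IH; congr (App f _); apply: funext => j.
by case: eqP.
Qed.

Lemma fill_CApp_id f (ts : 'I_(ar f) -> T) i C t :
  fill C t = ts i -> fill (CApp f i ts C) t = App f ts.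
Proof.
by move=> e /=; congr (App f _); apply: funext => j; case: eqP => // ->.
Qed.

Lemma subst_comp sigma tau t :
  subst tau (subst sigma t) = subst (subst tau \o sigma) t.
Proof. by elim: t => //= f ts IH; congr (App f _); apply: funext. Qed.

Lemma subst_Var t : subst Var t = t.
Proof. by elim: t => //= f ts IH; congr (App f _); apply: funext. Qed.

Lemma eq_in_subst sigma tau t :
  (forall x, vars t x -> sigma x = tau x) <-> subst sigma t = subst tau t.
Proof.
elim: t => [y|f ts IH] /=; first by split=> [|e x ->] //; apply.
split=> [e|/App_inj e x [i _ xi]].
  congr (App f _); apply: funext => i; apply/IH => x xi.
  by apply: e; exists i.
by move: x xi; apply/IH; exact: (congr1 (fun h => h i) e).
Qed.

Lemma vars_subst sigma t x :
  vars (subst sigma t) x -> exists2 y, vars t y & vars (sigma y) x.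
Proof.
elim: t => [y|f ts IH] /=; first by exists y.
by case=> i _ /IH[y yi xy]; exists y => //; exists i.
Qed.

Lemma vars_fill t x : vars t x -> exists C, t = fill C (Var x).
Proof.
elim: t => [y -> |f ts IH [i _ /IH[C e]]]; first by exists Hole.
by exists (CApp f i ts C); rewrite fill_CApp_id.
Qed.


(** * Term measures and well-foundedness of proper encompassment *)

Fixpoint varlist t : seq {classic V} :=
  match t with
  | Var x => [:: x]
  | App f ts => flatten [seq varlist (ts i) | i <- enum 'I_(ar f)]
  end.

Lemma mem_varlist t (x : {classic V}) : (x \in varlist t) <-> vars t x.
Proof.
elim: t => [y|f ts IH]; first by rewrite inE; split=> [/eqP|->].
split=> [/flatten_mapP[i _ /IH xi]|[i _ /IH xi]]; first by exists i.
by apply/flatten_mapP; exists i; rewrite ?mem_enum.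
Qed.

Lemma varlist_rename (h : V -> V) t :
  varlist (subst (Var \o h) t) = map h (varlist t).
Proof.
elim: t => [//|f ts IH] /=; rewrite map_flatten -[in RHS]map_comp; congr flatten.
by apply: eq_map => i; exact: IH.
Qed.

(** The offset 2 makes even a constant larger than a variable, so that instantiating a variable with
    a non-variable term strictly increases the size. *)
Fixpoint tsize t : nat :=
  if t is App f ts then (\sum_(i < ar f) tsize (ts i)).+2 else 1.

Lemma tsize_gt0 t : 0 < tsize t.
Proof. by case: t. Qed.

Lemma tsize_arg f (ts : 'I_(ar f) -> T) i : tsize (ts i) < tsize (App f ts).
Proof. by rewrite /= ltnS (bigD1 i) //= -addnS leq_addr. Qed.

Lemma tsize_fill C t : C <> Hole -> tsize t < tsize (fill C t).
Proof.
elim: C => [//|f i ts C IH] _.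
apply: leq_ltn_trans (tsize_arg _ i); rewrite eqxx.
by case: C IH => [|g j us C] IH //; apply/ltnW/IH.
Qed.

Lemma tsize_subst sigma t : tsize t <= tsize (subst sigma t).
Proof.
elim: t => [y|f ts IH] /=; first exact: tsize_gt0.
by rewrite !ltnS; apply: leq_sum => i _; exact: IH.
Qed.

Lemma tsize_subst_var sigma t x :
  vars t x -> ~ is_var (sigma x) -> tsize t < tsize (subst sigma t).
Proof.
elim: t => [y -> /=|f ts IH [i _ xi] nx] /=.
  by case: (sigma y) => [z []|//]; exists z.
rewrite !ltnS (bigD1 i) //= [X in _ < X](bigD1 i) //= -addSn.
by rewrite leq_add ?IH //; apply: leq_sum => j _; exact: tsize_subst.
Qed.

Lemma encompasses_trans s t u :
  encompasses s t -> encompasses t u -> encompasses s u.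
Proof.
move=> [C [sigma ->]] [D [tau ->]]; rewrite subst_fill subst_comp -fill_comp.
by eexists; eexists.
Qed.

Lemma encompasses_refl s : encompasses s s.
Proof. by exists Hole, Var; rewrite /= subst_Var. Qed.

Lemma properly_encompassesW s t u :
  properly_encompasses s t -> encompasses t u -> properly_encompasses s u.
Proof.
move=> [st ts] tu; split; first exact: encompasses_trans tu.
by move=> us; apply: ts; exact: encompasses_trans us.
Qed.

(** This counts surplus variable occurrences, a degree of non-linearity that grows when two
    variables are identified. *)
Definition dups t := size (varlist t) - size (undup (varlist t)).

(* A proper instance of the same size identifies two variables. *)
Lemma properly_encompasses_measure s t : properly_encompasses s t ->
  tsize t < tsize s \/ tsize t = tsize s /\ dups t < dups s.
Proof.
move=> [[C [sigma ->]] nts].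
have le_st := tsize_subst sigma t.
have [CH|] := pselect (C = Hole); last first.
  by move=> /(@tsize_fill C (subst sigma t))/(leq_ltn_trans le_st); left.
move: nts; rewrite {}CH /= => nts.
move: le_st; rewrite leq_eqVlt => /orP[/eqP eq_st|]; last by left.
right; split=> //.
(* Without growth in size, [sigma] maps each variable of [t] to a variable; outside [t] the value of
   [h] is arbitrary. *)
have {eq_st} /choice[h hP] x : exists y, vars t x -> sigma x = Var y.
  have [xt|nxt] := pselect (vars t x); last by exists x.
  have [] := pselect (is_var (sigma x)) => [[y e]|]; first by exists y.
  by move=> /(tsize_subst_var xt); rewrite eq_st ltnn.
have {hP} e : subst sigma t = subst (Var \o h) t by exact/eq_in_subst.
move: nts; rewrite {}e => nts.
have [/existsNP[x /existsNP[y]]|hI] :=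
    pselect (~ forall x y, vars t x -> vars t y -> h x = h y -> x = y).
  move=> /not_implyP[/mem_varlist xt] /not_implyP[/mem_varlist yt].
  move=> /not_implyP[hxy xy].
  rewrite /dups varlist_rename size_map.
  have lt := @undup_map_lt {classic V} {classic V} h _ x y xt yt hxy xy.
  by apply: ltn_sub2l => //; apply: leq_trans lt (size_undup _).
(* If [h] is injective on the variables of [t], a left inverse [g] renames the instance back to [t],
   so the encompassment would not be proper. *)
exfalso; apply: nts; move/contrapT: hI => hI.
have /choice[g gP] z : exists x, forall y, vars t y -> h y = z -> y = x.
  have [[x [xt hx]]|nz] := pselect (exists x, vars t x /\ h x = z).
    by exists x => y yt hy; apply: hI => //; rewrite hx.
  by exists z => y yt hy; case: nz; exists y.
exists Hole, (Var \o g); rewrite /= subst_comp -[LHS]subst_Var.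
by apply/eq_in_subst => y yt /=; congr Var; exact: gP yt erefl.
Qed.

(** The pair of size and surplus occurrences decreases lexicographically; [n] and [k] bound its
    components, and [k] is chosen anew whenever [n] drops. *)
Lemma properly_encompasses_wf :
  well_founded (fun t s => properly_encompasses s t).
Proof.
suff H n k t : tsize t <= n -> dups t <= k ->
    Acc (fun t s => properly_encompasses s t) t by move=> t; exact: H.
elim: n k t => [|n IHn] k t; first by rewrite leqNgt tsize_gt0.
elim: k t => [|k IHk] t tn tk; constructor => u /properly_encompasses_measure.
all: move=> [lt|[eu lt]].
- by apply: (IHn (dups u)) => //; rewrite -ltnS; exact: leq_trans tn.
- by move: (leq_trans lt tk).
- by apply: (IHn (dups u)) => //; rewrite -ltnS; exact: leq_trans tn.
- by apply: IHk; rewrite ?eu // -ltnS; exact: leq_trans tk.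
Qed.

(** * Syntactic unification *)

Definition upd sigma (x : V) t : V -> T :=
  fun y => if `[< y = x >] then t else sigma y.

Lemma upd_eq sigma x t : upd sigma x t x = t.
Proof. by rewrite /upd; case: asboolP. Qed.

Lemma upd_neq sigma x t y : y <> x -> upd sigma x t y = sigma y.
Proof. by rewrite /upd; case: asboolP. Qed.

(** Descending along equal function symbols ends at a pair with a variable [x] on one side and [u]
    on the other, which every unifier must equate. The given unifier rules out a clash of
    symbols. *)
Lemma disagreement s t tau : unifier tau s t -> s <> t ->
  exists x u, [/\ u <> Var x,
    forall sigma, unifier sigma s t -> sigma x = subst sigma u,
    vars s x \/ vars t x & vars u `<=` vars s `|` vars t].
Proof.
rewrite /unifier; elim: s t => [x|f ts IH] [y|g us] e ne.
- exists x, (Var y); split=> //; [by move=> yx; apply: ne | by left].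
- by exists x, (App g us); split=> //; left.
- by exists y, (App f ts); split=> //; right.
- have fg := App_head e; subst g.
  have /existsNP[i nei] : ~ forall i, ts i = us i.
    by move=> tu; apply: ne; congr App; exact: funext.
  have ei sigma : subst sigma (App f ts) = subst sigma (App f us) ->
      subst sigma (ts i) = subst sigma (us i).
    by move=> /App_inj/(congr1 (fun h => h i)).
  have [x [u [ux xu xtu utu]]] := IH i (us i) (ei _ e) nei.
  exists x, u; split=> // [sigma /ei/xu //||].
    by case: xtu => ?; [left | right]; exists i.
  by move=> z /utu[] ?; [left | right]; exists i.
Qed.

(** Otherwise [tau x] would be a proper subterm of itself, against its size. *)
Lemma occurs_check tau x u : u <> Var x -> tau x = subst tau u -> ~ vars u x.
Proof.
move=> ux e /vars_fill[C uC].
have CH : C <> Hole by move=> CH; apply: ux; rewrite uC CH.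
move: e; rewrite uC subst_fill /= => /(congr1 tsize) e.
have CH' : subst_ctx tau C <> Hole by case: C CH {uC e}.
by move: (@tsize_fill _ (tau x) CH'); rewrite -e ltnn.
Qed.


(* Every unifier factors through the constructed one with itself as the
   mediating substitution, which is what makes the induction work. *)
Lemma mgu_exists s t tau : unifier tau s t -> exists mu, mgu mu s t.
Proof.
(* The induction is on the length of a list [W] covering the variables of both terms; each solved
   variable is filtered out of it. *)
suff H (n : nat) (W : seq {classic V}) s' t' : size W <= n ->
    (forall x : {classic V}, vars s' x \/ vars t' x -> x \in W) ->
    (exists tau', unifier tau' s' t') ->
  exists2 mu, unifier mu s' t' &
    forall tau', unifier tau' s' t' -> forall x, tau' x = subst tau' (mu x).
  move=> st; have [||mu mu1 mu2] := H _ (varlist s ++ varlist t) s t (leqnn _).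
  - by move=> x [] /mem_varlist xi; rewrite mem_cat xi ?orbT.
  - by exists tau.
  - by exists mu; split=> // tau' /mu2; exists tau'.
elim: n W s' t' => [|n IH] W {}s {}t Wn stW [rho rhoU];
    have [->|/(disagreement rhoU)[x [u [ux xu xst ust]]]] := pselect (s = t).
- by exists Var.
- by move: Wn (stW _ xst); rewrite leqn0 size_eq0 => /eqP ->.
- by exists Var.
have xnu := occurs_check ux (xu _ rhoU).
pose th := upd Var x u.
(* A unifier already equates [x] and [u], so precomposing it with [th] changes nothing. *)
have thE sigma : unifier sigma s t -> subst sigma \o th = sigma.
  move=> /xu e; apply: funext => y /=; rewrite /th.
  by have [->|yx] := pselect (y = x); rewrite ?upd_eq ?upd_neq.
have th_unif sigma : unifier sigma s t -> unifier sigma (subst th s) (subst th t).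
  by move=> sU; rewrite /unifier !subst_comp thE.
have [|||mu mu1 mu2] :=
    IH (filter (predC1 (x : {classic V})) W) (subst th s) (subst th t).
- rewrite size_filter -ltnS; apply: leq_trans Wn.
  rewrite -(count_predC (predC1 (x : {classic V})) W) -addn1 leq_add2l.
  by rewrite -has_count; apply/hasP; exists (x : {classic V});
    [exact: stW | rewrite /= eqxx].
- have thV w : vars w `<=` vars s `|` vars t -> forall y : {classic V},
      vars (subst th w) y -> y \in filter (predC1 (x : {classic V})) W.
    move=> wst y /vars_subst[z zw].
    rewrite mem_filter /th; have [->|zx] := pselect (z = x).
      rewrite upd_eq => yu; rewrite stW ?andbT /=; last exact: ust.
      by apply/eqP => yx; apply: xnu; rewrite -yx.
    rewrite upd_neq // => -> /=; rewrite stW ?andbT; last exact: wst.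
    exact/eqP.
  by move=> y [] /thV; apply=> z ?; [left | right].
- by exists rho; exact: th_unif.
exists (subst mu \o th); first by rewrite /unifier -!subst_comp.
move=> sigma sU y; rewrite /= subst_comp.
rewrite -[in LHS](thE _ sU) /=; apply/eq_in_subst => z _.
by apply: mu2; exact: th_unif.
Qed.

(** * Positions, rewrite steps and overlapping redexes *)

Implicit Types (X Y : set (T * T)) (P Q : set T) (p : seq nat).

Lemma subterm_at_App f (ts : 'I_(ar f) -> T) k p u :
  subterm_at (App f ts) (k :: p) = Some u ->
  exists2 i : 'I_(ar f), k = val i & subterm_at (ts i) p = Some u.
Proof.
by rewrite /=; case: (@insubP _ _ 'I_(ar f) k) => // i _ <-; exists i.
Qed.

Lemma subterm_at_val f (ts : 'I_(ar f) -> T) i p :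
  subterm_at (App f ts) (val i :: p) = subterm_at (ts i) p.
Proof. by rewrite /= valK. Qed.

Lemma subterm_at_subst sigma t p u :
  subterm_at t p = Some u -> subterm_at (subst sigma t) p = Some (subst sigma u).
Proof.
elim: p t => [|k p IH] t; first by case: t => [x|f ts] [<-] //=; case: (sigma x).
case: t => [//|f ts] /subterm_at_App[i -> /IH].
by rewrite -(subterm_at_val (fun i => subst sigma (ts i))).
Qed.

Lemma subst_replace_at sigma t p u v : subterm_at t p = Some u ->
  subst sigma (replace_at t p v) =
  replace_at (subst sigma t) p (subst sigma v).
Proof.
elim: p t => [|k p IH] t; first by case: t => [x|f ts] //=; case: (sigma x).
case: t => [//|f ts] /subterm_at_App[i -> /IH e] /=.
by congr App; apply: funext => j; rewrite val_eqE; case: eqP => // ->.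
Qed.

Lemma subterm_at_vars t p u : subterm_at t p = Some u -> vars u `<=` vars t.
Proof.
elim: p t => [|k p IH] t; first by case: t => [x|f ts] [<-].
by case: t => [//|f ts] /subterm_at_App[i _ /IH ui] x /ui; exists i.
Qed.

Lemma subterm_at_fill t p u : subterm_at t p = Some u -> exists C, t = fill C u.
Proof.
elim: p t => [|k p IH] t; first by case: t => [x|f ts] [<-]; exists Hole.
case: t => [//|f ts] /subterm_at_App[i _ /IH[C tC]].
by exists (CApp f i ts C); rewrite fill_CApp_id.
Qed.

Lemma rstep_rule X l r : X (l, r) -> rstep X l r.
Proof. by move=> /(RStep Hole Var); rewrite /= !subst_Var. Qed.

Lemma rstep_closed X C sigma s t :
  rstep X s t -> rstep X (fill C (subst sigma s)) (fill C (subst sigma t)).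
Proof.
case=> D tau l r lr; rewrite !subst_fill !subst_comp -!fill_comp.
exact: RStep.
Qed.

Lemma rstep_fill X C s t : rstep X s t -> rstep X (fill C s) (fill C t).
Proof. by move=> /(rstep_closed C Var); rewrite !subst_Var. Qed.

Lemma rstep_subst X sigma s t :
  rstep X s t -> rstep X (subst sigma s) (subst sigma t).
Proof. exact: (rstep_closed Hole). Qed.

Lemma rstep_mono X Y s t : X `<=` Y -> rstep X s t -> rstep Y s t.
Proof. by move=> XY [C sigma l r /XY]; exact: RStep. Qed.

Lemma rstep1E l r s t : rstep [set (l, r)] s t ->
  exists C sigma, s = fill C (subst sigma l) /\ t = fill C (subst sigma r).
Proof. by case=> C sigma _ _ [-> ->]; exists C, sigma. Qed.

Lemma rsteps_trans X s t u : rsteps X s t -> rsteps X t u -> rsteps X s u.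
Proof. exact: rt_trans. Qed.

Lemma rsteps_fill X C s t : rsteps X s t -> rsteps X (fill C s) (fill C t).
Proof.
elim=> [u v uv|u|u v w _ uv _]; [|exact: rt_refl|exact: rt_trans].
exact/rt_step/rstep_fill.
Qed.

Lemma rsteps_App X f (ts us : 'I_(ar f) -> T) :
  (forall i, rsteps X (ts i) (us i)) -> rsteps X (App f ts) (App f us).
Proof.
move=> tu.
(* In [mid A] exactly the arguments with index in [A] are already rewritten, so the arguments are
   reduced one after the other. *)
pose mid (A : seq 'I_(ar f)) :=
  App f (fun i => if i \in A then us i else ts i).
have -> : App f us = mid (enum 'I_(ar f)).
  by congr App; apply: funext => i; rewrite mem_enum.
elim: (enum _) => [|i A IH].
  rewrite (_ : mid [::] = App f ts); first exact: rt_refl.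
  by congr App; apply: funext.
apply: rsteps_trans IH _.
have [iA|iA] := boolP (i \in A).
  rewrite (_ : mid (i :: A) = mid A); first exact: rt_refl.
  by congr App; apply: funext => j; rewrite inE; case: eqP => // ->; rewrite iA.
have := rsteps_fill (CApp f i (fun j => if j \in A then us j else ts j) Hole)
  (tu i).
congr (rsteps X); congr App; apply: funext => j; rewrite ?inE /=.
  by case: eqP => // ->; rewrite (negbTE iA).
by case: eqP => // ->.
Qed.

Lemma rsteps_subst X sigma tau t :
  (forall x, rsteps X (sigma x) (tau x)) ->
  rsteps X (subst sigma t) (subst tau t).
Proof. by move=> st; elim: t => //= f ts IH; exact: rsteps_App. Qed.

(** The variable [x] may occur any number of times in [t], so a single step inside its value becomes
    a sequence of steps. *)
Lemma rsteps_upd X sigma x D a b t : sigma x = fill D a -> rstep X a b ->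
  rsteps X (subst sigma t) (subst (upd sigma x (fill D b)) t).
Proof.
move=> xD ab; apply: rsteps_subst => y.
have [->|yx] := pselect (y = x); last by rewrite upd_neq //; exact: rt_refl.
by rewrite upd_eq xD; exact/rsteps_fill/rt_step.
Qed.

(* Critical overlap versus variable overlap. *)
Lemma redex_in_instance X l sigma C a : subst sigma l = fill C a ->
  (exists p u, [/\ subterm_at l p = Some u, ~ is_var u, subst sigma u = a &
     forall b, fill C b = replace_at (subst sigma l) p b]) \/
  (exists x D, sigma x = fill D a /\ forall b, rstep X a b ->
     rsteps X (fill C b) (subst (upd sigma x (fill D b)) l)).
Proof.
elim: l C => [x|f ts IH] C e.
  by right; exists x, C; split=> // b _; rewrite /= upd_eq; exact: rt_refl.
case: C e => [|g i us C] /= e.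
  by left; exists [::], (App f ts); split=> // -[].
have fg := App_head e; subst g.
have ei j := congr1 (fun h => h j) (App_inj e).
have /IH : subst sigma (ts i) = fill C a by rewrite ei eqxx.
case=> [[p [u [tu nu ua uP]]]|[x [D [xD DP]]]].
  left; exists (val i :: p), u; split=> //=; first by rewrite valK.
  move=> b; congr App; apply: funext => j; rewrite val_eqE.
  by case: eqP => [->|/eqP ji]; rewrite ?uP // ei (negbTE ji).
right; exists x, D; split=> // b ab; apply: rsteps_App => j.
case: eqP => [->|/eqP ji]; first exact: DP.
have -> : us j = subst sigma (ts j) by rewrite ei (negbTE ji).
exact: rsteps_upd ab.
Qed.

(** Two positions of one term are nested or parallel. In the parallel case [D1 b'] is the first
    context with [b'] at the second position, and [D2 a'] is its mirror image; this dependence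
    replaces contexts with two holes. *)
Lemma fill_overlap C1 C2 a b : fill C1 a = fill C2 b ->
  [\/ exists D, a = fill D b /\ forall b', fill C2 b' = fill C1 (fill D b'),
      exists D, b = fill D a /\ forall a', fill C1 a' = fill C2 (fill D a') |
      exists D1 D2 : T -> ctx, forall a' b',
        [/\ fill (D1 b') a' = fill (D2 a') b', fill C1 a' = fill (D1 b) a' &
            fill C2 b' = fill (D2 a) b']].
Proof.
elim: C1 C2 => [|f i us C1 IH] C2 e; first by apply: Or31; exists C2.
case: C2 e => [|g j vs C2] e.
  by apply: Or32; exists (CApp f i us C1); split.
have fg := App_head e; subst g.
have ek k := congr1 (fun h => h k) (App_inj e).
have [ij|ij] := eqVneq i j.
  subst j; have uv k : k != i -> us k = vs k.
    by move=> ki; have := ek k; rewrite (negbTE ki).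
  have CE x y : x = y -> App f (fun k => if k == i then x else us k) =
      App f (fun k => if k == i then y else vs k).
    by move=> ->; congr App; apply: funext => k; case: eqP => // /eqP/uv ->.
  have /IH[[D [aD DP]]|[D [bD DP]]|[D1 [D2 DP]]] : fill C1 a = fill C2 b.
  - by have := ek i; rewrite !eqxx.
  - by apply: Or31; exists D; split=> // b' /=; apply/esym/CE/esym.
  - by apply: Or32; exists D; split=> // a' /=; apply/CE.
  - apply: Or33; exists (fun b' => CApp f i us (D1 b')).
    exists (fun a' => CApp f i us (D2 a')) => a' b' /=.
    have [-> -> ->] := DP a' b'; split=> //.
    exact/esym/CE.
apply: Or33.
exists (fun b' => CApp f i (fun k => if k == j then fill C2 b' else us k) C1).
exists (fun a' => CApp f j (fun k => if k == i then fill C1 a' else us k) C2).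
move=> a' b' /=; split; congr App; apply: funext => k.
- by case: eqP => // ->; rewrite (negbTE ij).
- case: eqP => // /eqP ki; case: eqP => // kj.
  by have := ek k; rewrite (negbTE ki) kj eqxx.
- case: eqP => // /eqP kj; have := ek k; rewrite (negbTE kj) => <-.
  by case: eqP.
Qed.

Lemma subst_bij_var (rho rho' : V -> V) sigma t : cancel rho rho' ->
  subst (sigma \o rho') (subst (Var \o rho) t) = subst sigma t.
Proof.
by move=> K; rewrite subst_comp; apply/eq_in_subst => x _ /=; rewrite K.
Qed.

(** With [P] equal to [gt w] this is connectedness below [w]. Both ends of every step lie in [P],
    while the empty conversion imposes no condition. *)
Definition conv_in X P : T -> T -> Prop :=
  clos_refl_trans T (fun s t => [/\ symstep X s t, P s & P t]).

Lemma conv_in_trans X P s t u :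
  conv_in X P s t -> conv_in X P t u -> conv_in X P s u.
Proof. exact: rt_trans. Qed.

Lemma conv_in_sym X P s t : conv_in X P s t -> conv_in X P t s.
Proof.
elim=> [u v [[uv|vu] Pu Pv]|u|u v w _ vu _ wv]; last exact: rt_trans wv vu.
- by apply: rt_step; split=> //; right.
- by apply: rt_step; split=> //; left.
- exact: rt_refl.
Qed.

Lemma conv_in_closed X P Q C sigma s t :
  (forall u, P u -> Q (fill C (subst sigma u))) -> conv_in X P s t ->
  conv_in X Q (fill C (subst sigma s)) (fill C (subst sigma t)).
Proof.
move=> PQ; elim=> [u v [uv /PQ Pu /PQ Pv]|u|u v w _ uv _]; last exact: rt_trans.
  apply: rt_step; split=> //.
  by case: uv => [uv|vu]; [left | right]; exact: rstep_closed.
exact: rt_refl.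
Qed.

Lemma conv_in_fill X P Q C s t :
  (forall u, P u -> Q (fill C u)) -> conv_in X P s t ->
  conv_in X Q (fill C s) (fill C t).
Proof.
move=> PQ /(@conv_in_closed X P Q C Var); rewrite !subst_Var; apply.
by move=> u; rewrite subst_Var; exact: PQ.
Qed.

Lemma conv_in_sub X P Q s t :
  P `<=` Q -> conv_in X P s t -> conv_in X Q s t.
Proof. exact: (@conv_in_fill X P Q Hole). Qed.

Lemma conversionE X s t : conversion X s t <-> conv_in X setT s t.
Proof.
split; elim=> [u v uv|u|u v w _ uv _];
  try (exact: rt_refl || exact: rt_trans).
- exact: rt_step.
- by apply: rt_step; case: uv.
Qed.

Lemma conversion_sym X s t : conversion X s t -> conversion X t s.
Proof. by move=> /conversionE/conv_in_sym/conversionE. Qed.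

Lemma conversion_rules X Y s t :
  (forall l r, Y (l, r) -> conversion X l r) ->
  conversion Y s t -> conversion X s t.
Proof.
have step u v : (forall l r, Y (l, r) -> conversion X l r) ->
    rstep Y u v -> conversion X u v.
  move=> YX [C sigma l r /YX/conversionE lr]; apply/conversionE.
  exact: conv_in_closed lr.
move=> YX; elim=> [u v [|]|u|u v w _ uv _]; last exact: rt_trans.
- exact: step.
- by move=> /(step _ _ YX)/conversion_sym.
- exact: rt_refl.
Qed.

Lemma conversion_rstep X Y s t :
  (forall l r, Y (l, r) -> conversion X l r) ->
  rstep Y s t -> conversion X s t.
Proof.
by move=> YX st; apply: (conversion_rules YX); apply: rt_step; left.
Qed.

(** * Reduction orders, termination and confluence from connectedness *)

Section ReductionOrder.
Variables (gt : T -> T -> Prop) (gt_red : reduction_order gt).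

Let gtT s t u := @gt_transitive _ _ _ _ gt_red s t u.

(** Closure under contexts would continue the step from [t] to [fill C t] to an infinite descent. *)
Lemma gt_no_context C t : ~ gt t (fill C t).
Proof.
elim: (gt_well_founded gt_red t) => {}t _ IH tC.
exact: IH tC (gt_context gt_red C tC).
Qed.

(** If [x] occurred in [t] only, substituting [s] for [x] would put [s] above a context filled with
    [s]. *)
Lemma gt_vars s t : gt s t -> vars t `<=` vars s.
Proof.
move=> st x xt; move: xt => /vars_fill[C tC]; apply: contrapT => xs.
have := gt_subst gt_red (upd Var x s) st.
rewrite tC subst_fill /= upd_eq (_ : subst _ s = s); first exact: gt_no_context.
rewrite -[RHS]subst_Var; apply/eq_in_subst => y ys.
by rewrite upd_neq // => yx; apply: xs; rewrite -yx.
Qed.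

(** A variable [x] above [t] either occurs in [t], contradicting [gt_no_context], or [t] is ground
    and substituting [t] for [x] yields [gt t t]. *)
Lemma gt_not_var s t : gt s t -> ~ is_var s.
Proof.
move=> st [x sx]; have tx := gt_vars st; move: st tx; rewrite {}sx => xt tx.
have [/vars_fill[C tC]|nx] := pselect (vars t x).
  by move: xt; rewrite tC; exact: gt_no_context.
have := gt_subst gt_red (fun=> t) xt; rewrite /= (_ : subst _ t = t).
  exact: gt_irreflexive.
rewrite -[RHS]subst_Var; apply/eq_in_subst => y yt.
by case: nx; rewrite -(tx _ yt).
Qed.

Section Rules.
Variables (X : set (T * T)) (X_gt : forall l r, X (l, r) -> gt l r).

Lemma trs_of_gt : is_trs X.
Proof.
by move=> l r /X_gt lr; split; [exact: gt_not_var lr | exact: gt_vars].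
Qed.

Lemma rstep_gt s t : rstep X s t -> gt s t.
Proof.
by case=> C sigma l r /X_gt lr; exact/(gt_context gt_red)/(gt_subst gt_red).
Qed.

Lemma gt_terminating : terminating X.
Proof.
apply: wf_incl (gt_well_founded gt_red) => t s; exact: rstep_gt.
Qed.

Lemma rsteps_conv_in w s t :
  gt w s -> rsteps X s t -> gt w t /\ conv_in X (gt w) s t.
Proof.
move=> + st; elim: st => [u v uv wu|u wu|u v x _ IH1 _ IH2 /IH1[/IH2[wx vx] uv]].
- have wv := gtT wu (rstep_gt uv).
  by split=> //; apply: rt_step; split=> //; left.
- by split=> //; exact: rt_refl.
- by split=> //; exact: rt_trans vx.
Qed.

Lemma joinable_conv_in w s t :
  gt w s -> gt w t -> joinable X s t -> conv_in X (gt w) s t.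
Proof.
move=> ws wt [v /(rsteps_conv_in ws)[_ sv] /(rsteps_conv_in wt)[_ tv]].
exact/(conv_in_trans sv)/conv_in_sym.
Qed.

(** This strengthens Newman's lemma: by well-founded induction all terms below [s] are confluent,
    which turns a conversion below [s] into joinability. *)
Lemma connected_confluent :
  (forall s t u, rstep X s t -> rstep X s u -> conv_in X (gt s) t u) ->
  confluent X.
Proof.
move=> conn.
move=> s; elim: (gt_well_founded gt_red s) => {}s _ IH t u.
move=> /(@clos_rt_rt1n _ _ _ _) st /(@clos_rt_rt1n _ _ _ _) su.
case: st => [|t1 t' st1 /(@clos_rt1n_rt _ _ _ _) t1t].
  by exists u; [exact: clos_rt1n_rt | exact: rt_refl].
case: su => [|u1 u' su1 /(@clos_rt1n_rt _ _ _ _) u1u].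
  by exists t'; [exact: rt_refl | exact/(rt_trans _ _ _ _ _ (rt_step _ _ _ _ st1))].
have [w tw uw] : joinable X t1 u1.
  have := conn _ _ _ st1 su1; move=> /(@clos_rt_rtn1 _ _ _ _).
  elim=> [|v x [vx sv sx] _ [w tw vw]]; first by exists t1; exact: rt_refl.
  (* A backward step keeps the common reduct [w]; a forward step uses confluence from [v], which
     lies below [s]. *)
  case: vx => vx; last by exists w => //; exact: rt_trans (rt_step _ _ _ _ vx) vw.
  have [y wy xy] := IH _ sv _ _ vw (rt_step _ _ _ _ vx).
  by exists y => //; exact: rt_trans wy.
have [w1 tw1 ww1] := IH _ (rstep_gt st1) _ _ t1t tw.
have [w2 w12 uw2] := IH _ (rstep_gt su1) _ _ (rt_trans _ _ _ _ _ uw ww1) u1u.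
by exists w2 => //; exact: rt_trans w12.
Qed.

Lemma normal_form_subterm t p u :
  normal_form X t -> subterm_at t p = Some u -> normal_form X u.
Proof.
by move=> nt /subterm_at_fill[C tC] v /(rstep_fill C); rewrite -tC; exact: nt.
Qed.

(** A reducible argument supplies the redex by induction; if all arguments are normal forms, the
    redex is at the root. *)
Lemma innermost_redex t : ~ normal_form X t ->
  exists D l r sigma, [/\ X (l, r), t = fill D (subst sigma l) &
    forall w, proper_subterm w (subst sigma l) -> normal_form X w].
Proof.
elim: t => [x|f ts IH] /existsNP[v /contrapT].
  move e: (Var x) => t tv; case: tv e => -[|//] sigma l r lr /= e.
  by exists Hole, l, r, sigma; split=> // w; rewrite -e => -[[]].
have [[i /IH[D [l [r [sigma [lr iD nf]]]]]] _|all_nf] :=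
    pselect (exists i, ~ normal_form X (ts i)).
  exists (CApp f i ts D), l, r, sigma; split=> //.
  by rewrite fill_CApp_id.
have {}all_nf i : normal_form X (ts i).
  by apply: contrapT => ni; apply: all_nf; exists i.
move e: (App f ts) => t tv; case: tv e => -[|g i us C] sigma l r lr /= e.
  exists Hole, l, r, sigma; split=> // w; rewrite -e => -[[//|k p] _].
  by move=> /subterm_at_App[i _]; exact: normal_form_subterm.
have fg := App_head e; subst g.
have := all_nf i; have := congr1 (fun h => h i) (App_inj e).
by rewrite eqxx => -> /(_ (fill C (subst sigma r)))[]; exact: RStep.
Qed.

(** * Connecting peaks through prime critical pairs *)

Hypothesis V_infinite : infinite_set [set: V].
Hypothesis PCP_connected : forall s t, PCP X (s, t) -> forall sigma w,
  gt w (subst sigma s) -> gt w (subst sigma t) ->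
  conv_in X (gt w) (subst sigma s) (subst sigma t).

(** A variable overlap is joinable, a rule overlapping itself at the root gives equal reducts, and
    any other overlap is an instance of a prime critical pair. *)
Lemma prime_peak l1 r1 l2 r2 C sigma1 sigma2 : X (l1, r1) -> X (l2, r2) ->
  subst sigma1 l1 = fill C (subst sigma2 l2) ->
  (forall w, proper_subterm w (subst sigma2 l2) -> normal_form X w) ->
  conv_in X (gt (subst sigma1 l1)) (subst sigma1 r1) (fill C (subst sigma2 r2)).
Proof.
move=> lr1 lr2 e nf.
have step2 : rstep X (subst sigma2 l2) (subst sigma2 r2).
  exact: (RStep Hole).
have gt1 : gt (subst sigma1 l1) (subst sigma1 r1).
  exact/(gt_subst gt_red)/X_gt.
have gt2 : gt (subst sigma1 l1) (fill C (subst sigma2 r2)).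
  by rewrite e; exact/(gt_context gt_red)/rstep_gt.
have [[p [u [lu nu ul2 uP]]]|[x [D [xD DP]]]] := redex_in_instance X e; last first.
  apply: joinable_conv_in => //.
  exists (subst (upd sigma1 x (fill D (subst sigma2 r2))) r1).
    exact: rsteps_upd step2.
  apply: rsteps_trans (DP _ step2) _; apply: rt_step.
  exact: (RStep Hole).
(* The inner rule is renamed apart from the outer one, so that [sigma1] and [sigma2] can be merged
   into one unifier [tau]. *)
have [rho [rho' rhoK rho'K] rhoP] :=
  rename_apart (varlist l2 ++ varlist r2) (varlist l1 ++ varlist r1) V_infinite.
pose l2' := subst (Var \o rho) l2; pose r2' := subst (Var \o rho) r2.
have disj x : vars l2' x \/ vars r2' x -> vars l1 x \/ vars r1 x -> False.
  move=> x2 x1.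
  have {x2} [y y2 yx] : exists2 y, vars l2 y \/ vars r2 y & x = rho y.
    by case: x2 => /vars_subst[y yl xy]; exists y; auto.
  have /negP[] : rho y \notin varlist l1 ++ varlist r1.
    by apply: rhoP; rewrite mem_cat; apply/orP;
      case: y2; [left|right]; exact/mem_varlist.
  by rewrite -yx mem_cat; apply/orP; case: x1; [left|right]; exact/mem_varlist.
(* Variants at the root form no overlap. The substitutions then agree on the left-hand side, hence
   on the right-hand side, whose variables occur on the left. *)
have [[p0 [pi _ [l1E r1E]]]|not_variant] :=
    pselect (p = [::] /\ variant (l2', r2') (l1, r1)).
  rewrite uP p0 (_ : replace_at _ [::] _ = subst sigma2 r2); last by case: subst.
  rewrite (_ : subst sigma1 r1 = subst sigma2 r2); first exact: rt_refl.
  have l12 : subst sigma1 l1 = subst sigma2 l2.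
    by move: lu ul2; rewrite p0; case: (l1) => [?|? ?] [<-].
  move: l12; rewrite l1E r1E /= /l2' /r2' !subst_comp => /eq_in_subst l12.
  by apply/eq_in_subst => x xr; apply: l12; exact: gt_vars (X_gt lr2) _ xr.
pose tau x :=
  if `[< vars l2' x \/ vars r2' x >] then sigma2 (rho' x) else sigma1 x.
have tau1 t : vars t `<=` vars l1 `|` vars r1 -> subst tau t = subst sigma1 t.
  move=> t1; apply/eq_in_subst => x /t1 x1; rewrite /tau; case: asboolP => // x2.
  by case: (disj x).
have tau2 t : vars (subst (Var \o rho) t) `<=` vars l2' `|` vars r2' ->
    subst tau (subst (Var \o rho) t) = subst sigma2 t.
  move=> t2; rewrite -(subst_bij_var sigma2 _ rhoK); apply/eq_in_subst => x /t2 x2.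
  by rewrite /tau; case: asboolP.
have tau_u : subst tau u = subst sigma1 u.
  by apply: tau1 => x /(subterm_at_vars lu); left.
have tau_l2 : subst tau l2' = subst sigma2 l2 by apply: tau2 => x; left.
have tau_r2 : subst tau r2' = subst sigma2 r2 by apply: tau2 => x; right.
have tau_l1 : subst tau l1 = subst sigma1 l1 by apply: tau1 => x; left.
have tau_r1 : subst tau r1 = subst sigma1 r1 by apply: tau1 => x; right.
have tau_unif : unifier tau l2' u by rewrite /unifier tau_l2 tau_u.
have [mu mu_mgu] := mgu_exists tau_unif.
have [delta /funext tauE] := mu_mgu.2 _ tau_unif.
have tau_comp t : subst delta (subst mu t) = subst tau t.
  by rewrite subst_comp; congr subst; rewrite tauE.
have mu_u := subterm_at_subst mu lu.
have cp : PCP X (replace_at (subst mu l1) p (subst mu r2'), subst mu r1).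
  exists l2', r2', p, l1, r1, u, mu; split=> //.
    split=> /=.
    - by exists (l2, r2) => //; exists rho => //; exists rho'.
    - exists (l1, r1) => //; exists id; first by exists id.
      by rewrite /= !subst_Var.
    - by rewrite -subset0 => x [x2 x1]; exact: (disj x).
    - by exists u; split=> //; exists tau.
    - by move=> p0 v; apply: not_variant.
  (* Primality: a step from a proper subterm of the most general instance would survive [delta] and
     reduce a proper subterm of the innermost redex. *)
  move=> v w; rewrite mu_u => -[<-] [q q0 wq] z /(rstep_subst delta).
  apply: nf; exists q => //; rewrite -tau_l2 -tau_comp.
  by apply: subterm_at_subst; rewrite mu_mgu.1.
have := PCP_connected cp (sigma := delta) (w := subst sigma1 l1).
rewrite (subst_replace_at _ _ mu_u) !tau_comp tau_r1 tau_r2 tau_l1 -uP.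
by move=> /(_ gt2 gt1)/conv_in_sym.
Qed.

(* A possibly non-prime peak is split at the reduct of an innermost redex
   inside the inner redex, which yields two peaks of the prime kind. *)
Lemma root_peak l1 r1 l2 r2 C sigma1 sigma2 : X (l1, r1) -> X (l2, r2) ->
  subst sigma1 l1 = fill C (subst sigma2 l2) ->
  conv_in X (gt (subst sigma1 l1)) (subst sigma1 r1) (fill C (subst sigma2 r2)).
Proof.
move=> lr1 lr2 e.
have /innermost_redex[D [l3 [r3 [sigma3 [lr3 e3 nf]]]]] :
    ~ normal_form X (subst sigma2 l2).
  by move=> /(_ (subst sigma2 r2))[]; exact: (RStep Hole).
have e13 : subst sigma1 l1 = fill (comp_ctx C D) (subst sigma3 l3).
  by rewrite fill_comp -e3.
apply: conv_in_trans (prime_peak lr1 lr3 e13 nf) _.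
rewrite fill_comp e; apply: conv_in_sym.
apply: conv_in_fill (prime_peak lr2 lr3 e3 nf) => u.
exact: gt_context.
Qed.

(** Nested redexes form a root peak inside a context; parallel redexes commute. *)
Lemma local_peak s t u : rstep X s t -> rstep X s u -> conv_in X (gt s) t u.
Proof.
case=> C1 sigma1 l1 r1 lr1; move e: (fill _ _) => s' su.
case: su e => C2 sigma2 l2 r2 lr2 e.
case: (fill_overlap e) => [[D [eD DP]]|[D [eD DP]]|[D1 [D2 DP]]].
- rewrite -e DP; apply: conv_in_fill (root_peak lr1 lr2 eD) => v.
  exact: gt_context.
- rewrite DP; apply/conv_in_sym.
  apply: conv_in_fill (root_peak lr2 lr1 eD) => v.
  exact: gt_context.
- rewrite -e; apply: joinable_conv_in.
  + by apply/rstep_gt; exact: RStep.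
  + by rewrite e; apply/rstep_gt; exact: RStep.
  exists (fill (D1 (subst sigma2 r2)) (subst sigma1 r1)).
    have [_ -> _] := DP (subst sigma1 r1) (subst sigma2 r2).
    have [-> _ _] := DP (subst sigma1 r1) (subst sigma2 r2).
    have [-> _ _] := DP (subst sigma1 r1) (subst sigma2 l2).
    by apply: rt_step; exact: RStep.
  have [_ _ ->] := DP (subst sigma1 r1) (subst sigma2 r2).
  have [<- _ _] := DP (subst sigma1 l1) (subst sigma2 r2).
  by apply: rt_step; exact: RStep.
Qed.

Lemma prime_critical_pair_theorem : complete X.
Proof.
split; first exact: gt_terminating.
exact/connected_confluent/local_peak.
Qed.

End Rules.

(** * Effect of single inference steps on rules and equations *)

Lemma run_removed (Z : nat -> set (T * T)) x :
  run_union Z x -> ~ persistent Z x -> exists i, Z i x /\ ~ Z i.+1 x.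
Proof.
move=> [i _ ix] np; apply: contrapT => /forallNP nrem; apply: np.
exists i => // j /= ij; rewrite -(subnKC ij); elim: (j - i) => [|k IH].
  by rewrite addn0.
by rewrite addnS; apply: contrapT => nk; apply: (nrem (i + k)).
Qed.

Lemma kb_step_gt E R E' R' : kb_step gt E R E' R' ->
  (forall l r, R (l, r) -> gt l r) -> forall l r, R' (l, r) -> gt l r.
Proof.
case=> {E R E' R'} //.
- by move=> E R s t _ st IH l r [/IH|[-> ->]].
- by move=> E R s t _ ts IH l r [/IH|[-> ->]].
- move=> E R s t u _ tu IH l r [lr|[-> ->]]; first by apply: IH; left.
  apply: gtT (IH s t _) _; first by right.
  by apply: rstep_gt tu => l' r' lr'; apply: IH; left.
- by move=> E R t s u l r _ _ _ _ IH l' r' lr'; apply: IH; left.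
Qed.

(** Soundness is stated relative to an arbitrary [X], so that it iterates along a run with [X] the
    initial equations. *)
Lemma kb_step_conversion X E R E' R' : kb_step gt E R E' R' ->
  (forall s t, E (s, t) \/ R (s, t) -> conversion X s t) ->
  forall s t, E' (s, t) \/ R' (s, t) -> conversion X s t.
Proof.
have step (Y Z : set (T * T)) s t : Y `<=` Z ->
    (forall s t, Z (s, t) -> conversion X s t) ->
    rstep Y s t -> conversion X s t.
  by move=> YZ ZX; apply: conversion_rstep => l r /YZ; exact: ZX.
move=> EE' IH; have {}IH : forall s t, (E `|` R) (s, t) -> conversion X s t by [].
case: EE' IH => {E R E' R'}.
- move=> E R s t u us ut IH s' t' [[?|[-> ->]]|?].
  + by apply: IH; left.
  + apply: rt_trans (step R _ _ _ _ IH ut); last by right.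
    by apply/conversion_sym/(step R _ _ _ _ IH us); right.
  + by apply: IH; right.
- move=> E R s t _ _ IH s' t' [?|[?|[-> ->]]]; apply: IH.
  + by left; left.
  + by right.
  + by left; right.
- move=> E R s t _ _ IH s' t' [?|[?|[-> ->]]]; last apply: conversion_sym; apply: IH.
  + by left; left.
  + by right.
  + by left; right.
- by move=> E R s _ IH s' t' [?|?]; apply: IH; [left; left | right].
- move=> E R s t u _ tu IH s' t' [?|[?|[-> ->]]].
  + by apply: IH; left.
  + by apply: IH; right; left.
  + apply: rt_trans (IH s t _) (step R _ _ _ _ IH tu); first by right; right.
    by move=> ? ?; right; left.
- move=> E R s t u _ su IH s' t' [[?|[-> ->]]|?].
  + by apply: IH; left; left.
  + apply: rt_trans (IH s t _); last by left; right.
    by apply/conversion_sym/(step R _ _ _ _ IH su) => ? ?; right.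
  + by apply: IH; right.
- move=> E R s t u _ tu IH s' t' [[?|[-> ->]]|?].
  + by apply: IH; left; left.
  + apply: rt_trans (IH s t _) (step R _ _ _ _ IH tu); first by left; right.
    by move=> ? ?; right.
  + by apply: IH; right.
- move=> E R t s u l r _ lr tu _ IH s' t' [[?|[-> ->]]|?].
  + by apply: IH; left.
  + apply: rt_trans (IH t s _); last by right; right.
    apply/conversion_sym/(step [set (l, r)] _ _ _ _ IH tu) => _ ->.
    by right; left.
  + by apply: IH; right; left.
Qed.

(** Only compose and collapse can remove a rule. The rules they rewrite with survive the inference,
    so the steps can be taken in [R']. *)
Lemma kb_rule_removed E R E' R' l r :
  kb_step gt E R E' R' -> R (l, r) -> ~ R' (l, r) ->
  (exists u, rstep R' r u /\ R' (l, u)) \/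
  (exists u l' r', [/\ R' (l', r'), rstep [set (l', r')] l u,
     properly_encompasses l l' & E' (u, r)]).
Proof.
case=> {E R E' R'} //.
- by move=> E R s t _ _ lr []; left.
- by move=> E R s t _ _ lr []; left.
- move=> E R s t u _ tu [lr []|[-> ->] _]; first by left.
  left; exists u; split; last by right.
  by apply: rstep_mono tu => ?; left.
- move=> E R t s u l' r' _ lr' tu tl' [//|[-> ->] _].
  by right; exists u, l', r'; split=> //; right.
Qed.

Lemma kb_equation_removed E R E' R' s t :
  kb_step gt E R E' R' -> E (s, t) -> ~ E' (s, t) ->
  s = t \/ [\/ R' (s, t), R' (t, s), exists2 u, rstep R' s u & E' (u, t) |
               exists2 u, rstep R' t u & E' (s, u)].
Proof.
case=> {E R E' R'} //.
- by move=> E R s' t' u _ _ st []; left.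
- by move=> E R s' t' _ _ [//|[-> ->]] _; right; apply: Or41; right.
- by move=> E R s' t' _ _ [//|[-> ->]] _; right; apply: Or42; right.
- by move=> E R s' _ [//|[-> ->]] _; left.
- move=> E R s' t' u _ su [? []|[-> ->]]; first by left.
  by right; apply: Or43; exists u => //; right.
- move=> E R s' t' u _ su [? []|[-> ->]]; first by left.
  by right; apply: Or44; exists u => //; right.
- by move=> E R t' s' u l' r' _ _ _ _ st []; left.
Qed.

(** The reflexive closure is taken because a conversion starting at [s] visits [s] itself. *)
Definition below s : set T := fun v => v = s \/ gt s v.

Lemma gt_below s t v : gt s t -> below t v -> gt s v.
Proof. by move=> st [->//|]; exact: gtT. Qed.

Lemma below_gt s t : gt s t -> below t `<=` below s.
Proof. by move=> st v /(gt_below st); right. Qed.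

Lemma below_closed C sigma s v :
  below s v -> below (fill C (subst sigma s)) (fill C (subst sigma v)).
Proof.
move=> [->|sv]; [by left | right].
exact/(gt_context gt_red)/(gt_subst gt_red).
Qed.

(** * Bounded conversions for the rules and equations of a run *)

Section Run.
Variables (E R : nat -> set (T * T)).
Hypothesis run : infinite_run gt E R.
Hypothesis E_vanishes : persistent E = set0.

Lemma run_gt l r : run_union R (l, r) -> gt l r.
Proof.
move=> [i _]; elim: i l r => [|i IH] l r; first by rewrite run.1.
by apply: kb_step_gt (run.2 i) IH l r.
Qed.

Lemma persistent_sub (Z : nat -> set (T * T)) : persistent Z `<=` run_union Z.
Proof. by move=> x [i _ ix]; exists i => //; apply: ix => /=. Qed.

Lemma rstep_run_union i s t : rstep (R i) s t -> rstep (run_union R) s t.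
Proof. by apply: rstep_mono => x; exists i. Qed.

(** Every equation is eventually removed, leaving a trivial identity, a rule, or an equation with a
    smaller side; hence the nested induction on [s] and [t]. The set [D] delimits where rewrite
    steps are already known to be bounded, which allows a use inside the induction on rules. *)
Lemma equation_bounded (D : set T) :
  (forall s u, D s -> gt s u -> D u) ->
  (forall s u, D s -> rstep (run_union R) s u ->
     conv_in (persistent R) (below s) s u) ->
  forall s t, D s -> D t -> run_union E (s, t) ->
    conv_in (persistent R) (below s `|` below t) s t.
Proof.
move=> D_gt D_step s; elim: (gt_well_founded gt_red s) => {}s _ IHs t.
elim: (gt_well_founded gt_red t) => {}t _ IHt Ds Dt st.
have stepl u : rstep (run_union R) s u ->
    conv_in (persistent R) (below s `|` below t) s u.
  by move=> /(D_step _ _ Ds); apply: conv_in_sub => ? ?; left.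
have stepr u : rstep (run_union R) t u ->
    conv_in (persistent R) (below s `|` below t) u t.
  move=> /(D_step _ _ Dt)/conv_in_sym.
  by apply: conv_in_sub => ? ?; right.
have [|i [sti nsti]] := run_removed st; first by rewrite E_vanishes.
case: (kb_equation_removed (run.2 i) sti nsti) => [->|]; first exact: rt_refl.
case=> [r|r|[u /rstep_run_union su ut]|[u /rstep_run_union tu su]].
- by apply/stepl/rstep_rule; exists i.+1.
- by apply/stepr/rstep_rule; exists i.+1.
- have gsu := rstep_gt run_gt su; apply: conv_in_trans (stepl _ su) _.
  apply: (conv_in_sub _ (IHs _ gsu _ (D_gt _ _ Ds gsu) Dt _)); last by exists i.+1.
  by apply: setSU; exact: below_gt.
- have gtu := rstep_gt run_gt tu; apply: conv_in_trans _ (stepr _ tu).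
  apply: (conv_in_sub _ (IHt _ gtu Ds (D_gt _ _ Dt gtu) _)); last by exists i.+1.
  by apply: setUS; exact: below_gt.
Qed.

(* The induction is on [l] with respect to [gt] and proper encompassment
   combined; only composition keeps [l], and it decreases [r]. *)
Lemma rule_bounded l r :
  run_union R (l, r) -> conv_in (persistent R) (below l) l r.
Proof.
(* A left-hand side encompassed by a term below [l] need not itself be below [l]. The outer
   induction therefore runs on a bound [m] encompassing [l]. *)
suff H m : forall l, encompasses m l -> forall r, run_union R (l, r) ->
    conv_in (persistent R) (below l) l r by exact: H (encompasses_refl l) r.
elim: (gt_well_founded gt_red m) => {l r}m _ IHm l.
elim: (properly_encompasses_wf l) => {}l _ IHl ml r.
elim: (gt_well_founded gt_red r) => {}r _ IHr lr.
(* Every rule applicable to a term of [D] is covered by one of the two outer induction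
   hypotheses. *)
pose D : set T := fun z =>
  (exists2 y, gt l y & encompasses y z) \/ properly_encompasses l z.
have gt_fill y C sigma z z' : y = fill C (subst sigma z) -> gt z z' ->
    gt y (fill C (subst sigma z')).
  by move=> -> zz'; exact/(gt_context gt_red)/(gt_subst gt_red).
have D_gt z u : D z -> gt z u -> D u.
  move=> Dz zu; left; case: Dz => [[y ly [C [sigma yz]]]|[[C [sigma lz]] _]].
    exists (fill C (subst sigma u)); last by exists C, sigma.
    exact: gtT ly (gt_fill _ _ _ _ _ yz zu).
  exists (fill C (subst sigma u)); last by exists C, sigma.
  exact: gt_fill zu.
have D_step z u : D z -> rstep (run_union R) z u ->
    conv_in (persistent R) (below z) z u.
  move=> Dz; move e: z => z' zu; case: zu e => C sigma l' r' lr' e.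
  apply: (@conv_in_closed _ (below l')); first by move=> v; exact: below_closed.
  have zl' : encompasses z l' by exists C, sigma.
  case: Dz => [[y ly yz]|lz].
    (* Putting [y] in place of [l] within [m] gives a smaller bound that still encompasses [l']. *)
    case: ml => [C' [tau ml]]; apply: IHm (gt_fill _ _ _ _ _ ml ly) _ _ _ lr'.
    apply: encompasses_trans (encompasses_trans yz zl').
    by exists C', tau.
  have ll' := properly_encompassesW lz zl'.
  exact: IHl ll' (encompasses_trans ml ll'.1) _ lr'.
have gtl := run_gt lr.
have Dl z : gt l z -> D z by move=> lz; left; exists z => //; exact: encompasses_refl.
have [lrw|/(run_removed lr)[i [lri nlri]]] := pselect (persistent R (l, r)).
  apply: rt_step; split; [left; exact: rstep_rule | by left | by right].
case: (kb_rule_removed (run.2 i) lri nlri).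
  (* Composition: the innermost induction handles the rule from [l] to [u], and the step from [r] to
     [u] takes place below [l]. *)
  move=> [u [/rstep_run_union ru lu]]; have gru := rstep_gt run_gt ru.
  apply: conv_in_trans (IHr _ gru _) _; first by exists i.+1.
  apply/conv_in_sym/(conv_in_sub (below_gt gtl)).
  by apply: D_step ru; exact: Dl.
move=> [u [l' [r' [lr' lu ll' ur]]]].
have {}lr' : run_union R (l', r') by exists i.+1.
have glu : gt l u.
  by apply: rstep_gt lu => _ _ [-> ->]; exact: run_gt.
(* Collapse: the step from [l] to [u] is bounded since [l] properly encompasses [l']; the equation
   between [u] and [r] has both sides smaller than [l]. *)
apply: (@conv_in_trans _ _ _ u).
  have [C [sigma [eC ->]]] := rstep1E lu; rewrite {2}eC.
  apply: conv_in_closed (IHl _ ll' (encompasses_trans ml ll'.1) _ lr') => v.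
  by rewrite eC; exact: below_closed.
apply: (conv_in_sub _ (equation_bounded D_gt D_step (Dl _ glu) (Dl _ gtl) _)).
  by rewrite subUset; split; exact: below_gt.
by exists i.+1.
Qed.

Lemma run_equation_bounded s t : run_union E (s, t) ->
  conv_in (persistent R) (below s `|` below t) s t.
Proof.
apply: (@equation_bounded setT) => // {}s u _ [C sigma l r /rule_bounded].
by apply: conv_in_closed => v; exact: below_closed.
Qed.

Lemma run_conversion i s t :
  E i (s, t) \/ R i (s, t) -> conversion (E 0) s t.
Proof.
elim: i s t => [|i IH]; last exact: kb_step_conversion (run.2 i) IH.
by rewrite run.1 => s t [st|//]; apply: rt_step; left; exact: rstep_rule.
Qed.

End Run.
End ReductionOrder.
End Terms.

Theorem theorem6p12 (F : Type) (ar : F -> nat) (V : Type)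
  (V_infinite : infinite_set [set: V])
  (gt : term ar V -> term ar V -> Prop) (gt_red : reduction_order gt)
  (E R : nat -> set (term ar V * term ar V))
  (run : infinite_run gt E R) (run_fair : fair E R) :
  complete_presentation (persistent R) (E 0).
Proof.
have [E0 pcp] := run_fair.
have Rgt l r : persistent R (l, r) -> gt l r.
  by move=> lr; apply: (run_gt gt_red run); exact: persistent_sub lr.
split.
- exact: (trs_of_gt gt_red Rgt).
- apply: (prime_critical_pair_theorem gt_red Rgt V_infinite).
  (* A pair that is an equation of the run is connected through terms below either side, hence below
     every [w] above both sides, also after instantiation. *)
  move=> s t /pcp[[v sv tv]|st] sigma w ws wt.
    apply: (joinable_conv_in gt_red Rgt) => //.
    have sub x y : rsteps (persistent R) x y ->
        rsteps (persistent R) (subst sigma x) (subst sigma y).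
      elim=> [a b ab|a|a b c _ ab _]; last exact: rt_trans.
        exact/rt_step/rstep_subst.
      exact: rt_refl.
    by exists (subst sigma v); exact: sub.
  have sub a b : gt w a -> gt w b -> below gt a `|` below gt b `<=` gt w.
    move=> wa wb; rewrite subUset; split=> v.
      exact: (gt_below gt_red wa).
    exact: (gt_below gt_red wb).
  have step a b : rstep (run_union E) a b -> gt w a -> gt w b ->
      conv_in (persistent R) (gt w) a b.
    case=> C tau l r lr wl wr; apply: (conv_in_sub (sub _ _ wl wr)).
    apply: conv_in_closed (run_equation_bounded gt_red run E0 lr) => v [] lv.
      by left; exact: (below_closed gt_red).
    by right; exact: (below_closed gt_red).
  case: st => /(rstep_subst sigma) st; last apply: conv_in_sym; exact: step st _ _.
(* Persistent rules follow from the initial equations by soundness; conversely, each initial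
   equation has a bounded conversion by persistent rules. *)
- move=> s t; split; apply: conversion_rules => l r lr.
    have [i _ lri] := persistent_sub lr.
    by apply: (run_conversion run (i := i)); right.
  apply/conversionE/(conv_in_sub (subsetT _)).
  by apply: (run_equation_bounded gt_red run E0); exists 0.
Qed.
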